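(* For every integer $n\ge 1$, $$|M(n)|\le \|\mathcal{M}_n\|,$$ where $M$ is the Mertens function, $\mathcal{M}_n=T\rho(\boldsymbol{\mu})$ is the matrix defined in the context, and $\|\cdot\|$ is the quadratic matrix norm.
   Context: Notation. $\mathbb{N}^\ast=\{1,2,3,\dots\}$; $[x]$ is the integer part; $\mu(k)$ is the Möbius function; $M(m)=\sum_{1\le k\le m}\mu(k)$ is the Mertens function, with $M(0)=0$. $\|A\|$ is the matrix 2-norm (operator norm for the Euclidean norm). Fix $n\in\mathbb{N}^\ast$. Define on $\mathbb{N}^\ast$ the equivalence relation $i\,\mathcal{R}\,j\iff[n/i]=[n/j]$. Its classes are intervals; exactly one is unbounded, namely $\widehat{\infty}=\{m: m>n\}$. $\mathcal{S}$ is the finite set of largest elements of the bounded classes, with its natural order, and $s=\#\mathcal{S}$. $\widehat{m}$ denotes the class of $m$. For $k\in\mathcal{S}$, $k^-$ is the predecessor of $k$ in $\mathcal{S}$, with the convention $1^-=0$. $\mathcal{R}$ is compatible with multiplication, so one can define the following commutative $\mathbb{Z}$-algebra $\boldsymbol{\mathcal{A}}$. It is the free $\mathbb{Z}$-module with basis $(\mathbf{k})_{k\in\mathcal{S}}$, with bilinear multiplication given, for $i,j\in\mathcal{S}$, by $\mathbf{i}\,\mathbf{j}=\mathbf{l}$, where $l\in\mathcal{S}$ is the largest element of the class of the integer $ij$, if $ij\le n$, and $\mathbf{i}\,\mathbf{j}=0$ if $ij>n$. (Equivalently, $\boldsymbol{\mathcal{A}}$ is the quotient of the $\mathbb{Z}$-algebra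 of the monoid $\mathbb{N}^\ast/\mathcal{R}$ by the ideal $\mathbb{Z}\widehat{\infty}$.) For $\mathbf{a}\in\boldsymbol{\mathcal{A}}$, $\rho(\mathbf{a})$ is the $s\times s$ matrix (rows and columns indexed by $\mathcal{S}$) of the linear map $\mathbf{x}\mapsto\mathbf{a}\mathbf{x}$ in the basis $(\mathbf{k})_{k\in\mathcal{S}}$; its column of index $j$ holds the coordinates of $\mathbf{a}\,\mathbf{j}$. $T=T_n$ is the symmetric $s\times s$ matrix whose entry in position $(p,q)$, $1\le p,q\le s$, is $1$ if $p+q\le s+1$ (on or above the antidiagonal) and $0$ otherwise; its rows and columns are also indexed by $\mathcal{S}$ in increasing order. $\boldsymbol{\mu}=\sum_{k\in\mathcal{S}}\big(M(k)-M(k^-)\big)\mathbf{k}\in\boldsymbol{\mathcal{A}}$, and $\mathcal{M}_n=T\rho(\boldsymbol{\mu})$. *)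

(* Defs.v *)
From mathcomp Require Import all_boot all_order all_algebra.
From mathcomp Require Import classical_sets reals.

Set Implicit Arguments.
Unset Strict Implicit.
Unset Printing Implicit Defensive.

Import Order.TTheory GRing.Theory Num.Theory.
Local Open Scope ring_scope.

(* At k = 0 the value is junk. *)
Definition mobius (k : nat) : int :=
  if all (fun p => ~~ (p ^ 2 %| k)%N) (primes k)
  then (-1) ^+ size (primes k) else 0.

Definition mertens (m : nat) : int := \sum_(1 <= k < m.+1) mobius k.

(* Meant for positive i and j only. *)
Definition eqdiv (n i j : nat) : bool := (n %/ i == n %/ j)%N.

(* The bounded classes of eqdiv n partition {1, ..., n}, so it is enough to
   test maximality inside that interval; see mem_maxs. *)
Definition maxs (n : nat) : seq nat :=
  [seq k <- iota 1 n | all (fun j => eqdiv n j k ==> (j <= k)%N) (iota 1 n)].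

(* The largest element of the class of m, for 1 <= m <= n; see class_maxP. *)
Definition class_max (n m : nat) : nat :=
  (\max_(1 <= j < n.+1 | eqdiv n j m) j)%N.

Definition nmaxs (n : nat) : nat := size (maxs n).

Definition elt (n : nat) (i : 'I_(nmaxs n)) : nat := nth 0%N (maxs n) i.

(* The predecessor of k in maxs n; the empty maximum gives 0 when k = 1. *)
Definition predmax (n k : nat) : nat := (\max_(j <- maxs n | j < k) j)%N.

(* The free Z-module on maxs n, as coordinate columns; the coordinate of
   index i is that of the basis vector attached to elt i. *)
Definition alg (n : nat) : Type := 'cV[int]_(nmaxs n).

(* The basis vector attached to k, for k in maxs n. *)
Definition basis (n k : nat) : alg n := \col_i (elt i == k)%:R.

Definition basis_mul (n i j : nat) : alg n :=
  if (i * j <= n)%N then basis n (class_max n (i * j)) else 0.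

(* The bilinear extension of basis_mul. *)
Definition alg_mul (n : nat) (a b : alg n) : alg n :=
  \sum_i \sum_j (a i 0 * b j 0) *: basis_mul n (elt i) (elt j).

Definition rho (n : nat) (a : alg n) : 'M[int]_(nmaxs n) :=
  \matrix_(i, j) alg_mul a (basis n (elt j)) i 0.

(* Indices start at 0, so that p + q <= s + 1 reads i.+1 + j.+1 <= s.+1. *)
Definition Tmx (n : nat) : 'M[int]_(nmaxs n) :=
  \matrix_(i, j) (i.+1 + j.+1 <= (nmaxs n).+1)%N%:R.

Definition mu_alg (n : nat) : alg n :=
  \sum_(k <- maxs n) (mertens k - mertens (predmax n k)) *: basis n k.

Definition mertens_mx (n : nat) : 'M[int]_(nmaxs n) :=
  Tmx n *m rho (mu_alg n).

(* The library norms on matrices are sup norms, hence the definitions below. *)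
Definition eucl_norm (R : realType) (m : nat) (x : 'cV[R]_m) : R :=
  Num.sqrt (\sum_i x i 0 ^+ 2).

Definition op_norm2 (R : realType) (m p : nat) (A : 'M[R]_(m, p)) : R :=
  sup [set eucl_norm (A *m x) | x in [set x | eucl_norm x <= 1]]%classic.

Lemma mem_maxs (n k : nat) : (0 < n)%N ->
  k \in maxs n <->
  (0 < k)%N /\ (forall j, (0 < j)%N -> eqdiv n j k -> (j <= k)%N).
Proof.
move=> n_gt0; rewrite mem_filter mem_iota add1n ltnS; split.
  case/and3P=> /allP mk k_gt0 le_kn; split=> // j j_gt0 jk.
  have le_jn: (j <= n)%N.
    rewrite leqNgt; apply: contraTN jk => lt_nj.
    by rewrite /eqdiv divn_small // eq_sym -lt0n divn_gt0.
  have j_in: j \in iota 1 n by rewrite mem_iota j_gt0 add1n ltnS.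
  exact: (implyP (mk j j_in)).
case=> k_gt0 mk; have le_kn: (k <= n)%N.
  rewrite leqNgt; apply/negP=> lt_nk.
  suff: (k.+1 <= k)%N by rewrite ltnn.
  by apply: mk => //; rewrite /eqdiv !divn_small // ltnS ltnW.
rewrite k_gt0 le_kn !andbT; apply/allP=> j; rewrite mem_iota => /andP[j_gt0 _].
by apply/implyP; apply: mk.
Qed.

Lemma class_maxP (n m : nat) : (0 < m <= n)%N ->
  class_max n m \in maxs n /\ eqdiv n (class_max n m) m.
Proof.
case/andP=> m_gt0 le_mn; set c := class_max n m.
have ub j : (0 < j)%N -> (j <= n)%N -> eqdiv n j m -> (j <= c)%N.
  move=> j_gt0 le_jn jm; rewrite /c /class_max.
  by apply: (@leq_bigmax_seq _ _ (eqdiv n ^~ m) id) => //;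
    rewrite mem_index_iota j_gt0.
have [c_le c_eq]: (c <= n)%N /\ (eqdiv n c m \/ c = 0%N).
  rewrite /c /class_max big_nat_cond.
  elim/big_ind: _ => [|x y [xn hx] [yn hy]|j /andP[/andP[_ jn] jm]].
  - by split; [|right].
  - by case: (leqP x y).
  - by split; [|left].
have c_gt0 : (0 < c)%N by apply: leq_trans m_gt0 (ub _ m_gt0 le_mn (eqxx _)).
case: c_eq => [c_eq|c0]; last by rewrite c0 in c_gt0.
split=> //; rewrite mem_filter mem_iota c_gt0 add1n ltnS c_le !andbT.
apply/allP=> j; rewrite mem_iota add1n ltnS => /andP[j_gt0 le_jn].
by apply/implyP=> /eqP jc; apply: ub => //; rewrite /eqdiv jc.
Qed.

(* Main.v *)
Require Import Defs.
From mathcomp Require Import all_boot all_order all_algebra.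
From mathcomp Require Import reals.
Import Order.TTheory GRing.Theory Num.Theory.
Local Open Scope ring_scope.

(** The number M(n) is itself an entry of the matrix, and the operator norm
    dominates the absolute value of every entry ([normr_entry_le_op_norm2]).

    The entry is the one in the first row and in the column of the basis
    vector attached to 1.  That vector is the unit of the algebra
    ([alg_mulr1]), so the corresponding column of [rho a] is [a]; the first
    row of [Tmx n] consists of ones, so the entry is the sum of the
    coordinates of [mu_alg n].  These coordinates are the increments of the
    Mertens function between consecutive elements of [maxs n], whose last
    element is n, and their sum telescopes to M(n) - M(0)
    ([sum_mu_alg]). *)

(** * The operator norm dominates the entries *)

Section OperatorNorm.

Variable R : realType.

Lemma normr_coord_le_eucl_norm m (x : 'cV[R]_m) i : `|x i 0| <= eucl_norm x.
Proof.
rewrite -sqrtr_sqr ler_wsqrtr // (bigD1 i) //= lerDl.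
by apply: sumr_ge0 => j _; apply: sqr_ge0.
Qed.

Lemma eucl_norm_delta m (j : 'I_m) : eucl_norm (delta_mx j 0 : 'cV[R]_m) = 1.
Proof.
rewrite /eucl_norm (bigD1 j) //= big1 => [|i ij].
  by rewrite mxE !eqxx expr1n addr0 sqrtr1.
by rewrite mxE (negbTE ij) expr0n.
Qed.

(** The supremum defining [op_norm2] is that of a bounded set, hence a
    genuine upper bound: on the unit ball the i-th coordinate of [A *m x] is
    at most the sum of the absolute values of the i-th row of [A]. *)
Lemma eucl_norm_mulmx_le m p (A : 'M[R]_(m, p)) (x : 'cV[R]_p) :
  eucl_norm x <= 1 -> eucl_norm (A *m x) <= op_norm2 A.
Proof.
move=> x1; apply: ub_le_sup; last by exists x.
exists (Num.sqrt (\sum_i (\sum_j `|A i j|) ^+ 2)) => _ [y /= y1 <-].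
apply/ler_wsqrtr/ler_sum => i _.
rewrite -real_normK ?num_real // lerXn2r ?nnegrE ?sumr_ge0 //.
rewrite mxE; apply: le_trans (ler_norm_sum _ _ _) _.
apply: ler_sum => j _; rewrite normrM ler_piMr //.
exact: le_trans (normr_coord_le_eucl_norm _ _ _) y1.
Qed.

Lemma normr_entry_le_op_norm2 m p (A : 'M[R]_(m, p)) i j :
  `|A i j| <= op_norm2 A.
Proof.
have -> : A i j = (A *m delta_mx j 0 : 'cV_m) i 0 by rewrite -colE mxE.
apply: le_trans (normr_coord_le_eucl_norm _ _ _) _.
by apply: eucl_norm_mulmx_le; rewrite eucl_norm_delta.
Qed.

End OperatorNorm.

(** * Telescoping along an increasing sequence *)

Lemma bigmax_sorted (s : seq nat) :
  sorted ltn s -> (\max_(j <- s) j)%N = last 0%N s.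
Proof.
elim/last_ind: s => [|s x IHs] sx; first by rewrite big_nil.
rewrite -cats1 big_cat big_seq1 last_cat /=; apply/maxn_idPr.
rewrite IHs; last first.
  by apply: subseq_sorted (subseq_rcons s x) sx; apply: ltn_trans.
case: s {IHs} sx => [|y s] //=.
by rewrite rcons_path => /andP[_ /ltnW].
Qed.

(** The inner maximum is the predecessor of [k] in [s], or 0 if [k] is the
    first element. *)
Lemma telescope_sorted (V : zmodType) (f : nat -> V) (s : seq nat) :
    sorted ltn s ->
  \sum_(k <- s) (f k - f (\max_(j <- s | j < k) j)%N) = f (last 0%N s) - f 0%N.
Proof.
elim/last_ind: s => [|s x IHs] sx; first by rewrite big_nil subrr.
have ss : sorted ltn s.
  by apply: subseq_sorted (subseq_rcons s x) sx; apply: ltn_trans.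
have lt_x k : k \in s -> (k < x)%N.
  move: sx; rewrite -cats1 sorted_pairwise; last exact: ltn_trans.
  by rewrite pairwise_cat allrel1r => /and3P[/allP lt_s _ _] /lt_s.
rewrite big_rcons last_rcons /=.
(* Appending x changes no predecessor of an element of s. *)
have -> : \sum_(k <- s) (f k - f (\max_(j <- rcons s x | j < k) j)%N)
        = f (last 0%N s) - f 0%N.
  rewrite -IHs //; apply: eq_big_seq => k /lt_x lt_kx.
  by rewrite -cats1 big_cat /= big_cons big_nil ltnNge (ltnW lt_kx) maxn0.
have -> : (\max_(j <- rcons s x | j < x) j)%N = last 0%N s.
  rewrite -bigmax_sorted // -cats1 big_cat /= big_cons big_nil ltnn maxn0.
  rewrite big_seq_cond [RHS]big_seq_cond; apply: eq_bigl => k.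
  by case: (boolP (k \in s)) => // /lt_x ->.
by rewrite addrC addrA subrK.
Qed.

(** * The largest elements of the bounded classes *)

Section Maxs.

Variable n : nat.
Hypothesis n_gt0 : (0 < n)%N.

Lemma sorted_maxs : sorted ltn (maxs n).
Proof. by apply: sorted_filter (iota_ltn_sorted _ _); apply: ltn_trans. Qed.

Lemma uniq_maxs : uniq (maxs n).
Proof. exact: filter_uniq (iota_uniq _ _). Qed.

Lemma maxs_bounds k : k \in maxs n -> (0 < k <= n)%N.
Proof. by rewrite mem_filter mem_iota add1n ltnS => /andP[]. Qed.

Lemma n_in_maxs : n \in maxs n.
Proof.
rewrite mem_filter mem_iota n_gt0 add1n ltnSn !andbT.
by apply/allP => j; rewrite mem_iota add1n ltnS => /andP[_ ->]; rewrite implybT.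
Qed.

Lemma one_in_maxs : 1%N \in maxs n.
Proof.
apply/mem_maxs => //; split=> // j j_gt0; apply: contraLR.
by rewrite -ltnNge /eqdiv divn1 => j_gt1; rewrite ltn_eqF // ltn_Pdiv.
Qed.

Lemma last_maxs : last 0%N (maxs n) = n.
Proof.
rewrite -bigmax_sorted ?sorted_maxs //; apply/eqP; rewrite eqn_leq.
rewrite (@leq_bigmax_seq _ _ xpredT id) ?n_in_maxs // andbT.
by apply/bigmax_leqP_seq => k /maxs_bounds/andP[].
Qed.

Lemma class_max_id k : k \in maxs n -> class_max n k = k.
Proof.
move=> k_in; have k_bounds := maxs_bounds _ k_in.
have [c_in c_eq] := class_maxP k_bounds.
have [k_gt0 k_max] := (mem_maxs k n_gt0).1 k_in.
have [c_gt0 c_max] := (mem_maxs _ n_gt0).1 c_in.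
apply/eqP; rewrite eqn_leq k_max //= c_max //.
by rewrite /eqdiv eq_sym.
Qed.

Lemma elt_in_maxs (i : 'I_(nmaxs n)) : elt i \in maxs n.
Proof. exact: mem_nth. Qed.

Lemma elt_inj : injective (@elt n).
Proof.
by move=> i j /eqP; rewrite /elt nth_uniq ?uniq_maxs // => /eqP/val_inj.
Qed.

Lemma elt_surj k : k \in maxs n -> exists i : 'I_(nmaxs n), elt i = k.
Proof.
move=> k_in; have lt_k : (index k (maxs n) < nmaxs n)%N by rewrite index_mem.
by exists (Ordinal lt_k); rewrite /elt nth_index.
Qed.

(** * The algebra and its unit *)

Lemma basis_elt (j : 'I_(nmaxs n)) : basis n (elt j) = delta_mx j 0.
Proof. by apply/colP => i; rewrite !mxE (inj_eq elt_inj) andbT. Qed.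

Lemma basis_mulr1 k : k \in maxs n -> basis_mul n k 1 = basis n k.
Proof.
move=> k_in; have /andP[_ le_kn] := maxs_bounds _ k_in.
by rewrite /basis_mul muln1 le_kn class_max_id.
Qed.

Lemma alg_mulr1 (a : alg n) : alg_mul a (basis n 1) = a.
Proof.
have [j elt_j] := elt_surj _ one_in_maxs.
rewrite -elt_j basis_elt [RHS]matrix_sum_delta; apply: eq_bigr => i _.
rewrite big_ord1 (bigD1 j) //= big1 => [|k kj].
  by rewrite mxE !eqxx mulr1 elt_j basis_mulr1 ?elt_in_maxs // basis_elt addr0.
by rewrite mxE (negbTE kj) mulr0 scale0r.
Qed.

(** * The Mertens function as an entry *)

Lemma sum_mu_alg : \sum_i mu_alg n i 0 = mertens n.
Proof.
transitivity (\sum_(k <- maxs n) (mertens k - mertens (predmax n k))).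
  rewrite /mu_alg; under eq_bigr do rewrite summxE.
  rewrite exchange_big; apply: eq_big_seq => k /elt_surj[j <-].
  rewrite (bigD1 j) //= big1 => [|i ij]; rewrite basis_elt !mxE.
    by rewrite !eqxx mulr1 addr0.
  by rewrite (negbTE ij) mulr0.
rewrite telescope_sorted ?sorted_maxs // last_maxs.
by rewrite {2}/mertens big_geq // subr0.
Qed.

Lemma mertens_mx_entry : exists i j, mertens_mx n i j = mertens n.
Proof.
have [j elt_j] := elt_surj _ one_in_maxs.
have s_gt0 : (0 < nmaxs n)%N by apply: leq_ltn_trans (ltn_ord j).
exists (Ordinal s_gt0), j; rewrite -sum_mu_alg mxE; apply: eq_bigr => k _.
by rewrite !mxE elt_j alg_mulr1 add1n ltnS ltn_ord mul1r.
Qed.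

End Maxs.

Theorem mainTheorem1 (R : realType) (n : nat) (n_gt0 : (0 < n)%N) :
  `|mertens n|%:~R <= op_norm2 (map_mx intr (mertens_mx n) : 'M[R]_(nmaxs n)).
Proof.
have [i [j <-]] := mertens_mx_entry _ n_gt0.
apply: le_trans (normr_entry_le_op_norm2 _ _ _ _ i j).
by rewrite [in leRHS]mxE intr_norm.
Qed.
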